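(* Let $p$ be an odd prime and $\epsilon\ge 0$. Let $X\subseteq\mathbb{H}_1(\mathbb{F}_p)$ and $E\subseteq\mathbb{F}_p^3\setminus(\mathbb{F}_p^2\times\{0\})$. Assume that for every $(y,z)\in\mathbb{F}_p^2$ we have $|\pi_{23}^{-1}(y,z)\cap E|\le p^{1-\epsilon}$. Then \[|X(E)|\gg\min\left\{p^3,~\frac{|X||E|}{p^{3-\frac{\epsilon}{2}}}\right\}.\]
   Context: $\mathbb{H}_1(\mathbb{F}_p)$ is the group of $3\times 3$ matrices $[x,y,t]=\begin{pmatrix}1&x&t\\0&1&y\\0&0&1\end{pmatrix}$ with $x,y,t\in\mathbb{F}_p$, acting on $\mathbb{F}_p^3$ by matrix multiplication on column vectors. $X(E)=\{\theta e: e\in E,\ \theta\in X\}$. $\pi_{23}:\mathbb{F}_p^3\to\mathbb{F}_p^2$, $\pi_{23}(x,y,z)=(y,z)$. $A\gg B$ means $A\ge cB$ for an absolute constant $c>0$ independent of $p,X,E,\epsilon$. *)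

(* Defs.v *)
From HB Require Import structures.
From mathcomp Require Import all_boot all_order all_algebra.
From mathcomp Require Import all_classical all_reals all_analysis.

Set Implicit Arguments.
Unset Strict Implicit.
Unset Printing Implicit Defensive.

Import Order.TTheory GRing.Theory Num.Theory.

Local Open Scope ring_scope.

Definition heis_mx (F : fieldType) (x y t : F) : 'M[F]_3 :=
  \matrix_(i < 3, j < 3)
    nth 0 (nth [::] [:: [:: 1; x; t];
                        [:: 0; 1; y];
                        [:: 0; 0; 1]] i) j.

Definition heisenberg (F : finFieldType) : {set 'M[F]_3} :=
  [set heis_mx u.1.1 u.1.2 u.2 | u : F * F * F].

Definition mx_image (F : finFieldType) (X : {set 'M[F]_3})
    (E : {set 'cV[F]_3}) : {set 'cV[F]_3} :=
  [set theta *m e | theta in X, e in E].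

(* Coordinates are numbered from 0, so this is (x, y, z) |-> (y, z). *)
Definition pi23 (F : fieldType) (v : 'cV[F]_3) : F * F := (v 1 0, v 2 0).

Definition horizontal_plane (F : finFieldType) : {set 'cV[F]_3} :=
  [set v : 'cV[F]_3 | v 2 0 == 0].

(* Main.v *)
(** An element of the Heisenberg group is determined by its [x]-entry together
    with the image of one vector [e] off the horizontal plane, so [X] sends [e]
    to at least [|X| / p] points, all at the height [z] of [e]. Each height
    carries at most [p * p^(1 - eps)] points of [E]; summing over [E] gives
    [|X| |E| <= p^(3 - eps) |X(E)|], so the constant [c = 1] works. *)

Require Import Defs.
From HB Require Import structures.
From mathcomp Require Import all_boot all_order all_algebra.
From mathcomp Require Import all_classical all_reals all_analysis.
From mathcomp Require Import lra.

Set Implicit Arguments.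
Unset Strict Implicit.
Unset Printing Implicit Defensive.

Import Order.TTheory GRing.Theory Num.Theory.

Local Open Scope ring_scope.

Lemma heis_mx_mulE (F : fieldType) (x y t : F) (v : 'cV[F]_3) :
  [/\ (heis_mx x y t *m v) 0 0 = v 0 0 + x * v 1 0 + t * v 2 0,
      (heis_mx x y t *m v) 1 0 = v 1 0 + y * v 2 0
    & (heis_mx x y t *m v) 2 0 = v 2 0].
Proof.
have e1 : lift ord0 ord0 = 1 :> 'I_3 by apply/val_inj.
have e2 : lift ord0 (lift ord0 ord0) = 2 :> 'I_3 by apply/val_inj.
by split; rewrite !mxE !big_ord_recl big_ord0 !mxE /= ?e1 ?e2
  ?(mul0r, mul1r, add0r, addr0, addrA).
Qed.

(** Once [x] is fixed, coordinates 0 and 1 of the image are affine in [t] and [y], with slope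
    [e 2 0], which is invertible. The image alone would only reveal a combination of [x] and [t],
    hence the pairing with [theta 0 1]. *)
Lemma heis_mx_inj_at (F : finFieldType) (e : 'cV[F]_3) : e 2 0 != 0 ->
  {in heisenberg F &,
    injective (fun theta : 'M[F]_3 => (theta 0 1, theta *m e))}.
Proof.
move=> e2 _ _ /imsetP[[[x y] t] _ ->] /imsetP[[[x' y'] t'] _ ->] /= [].
rewrite !mxE /= => -> eq_im.
have [h0 h1 _] := heis_mx_mulE x' y t e.
have [h0' h1' _] := heis_mx_mulE x' y' t' e.
move: h0 h1; rewrite {}eq_im {}h0' {}h1'.
by move=> /addrI/(mulIf e2) -> /addrI/(mulIf e2) ->.
Qed.

Lemma card_le_mx_image_height (F : finFieldType) (X : {set 'M[F]_3})
    (E : {set 'cV[F]_3}) (e : 'cV[F]_3) :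
  X \subset heisenberg F -> e \in E -> e 2 0 != 0 ->
  (#|X| <= #|F| * #|[set f in mx_image X E | f 2%R 0%R == e 2%R 0%R]|)%N.
Proof.
move=> /fintype.subsetP XH eE e2.
have inj := sub_in2 XH (heis_mx_inj_at e2).
rewrite -(card_in_imset inj) -cardsT -cardsX.
apply/subset_leq_card/fintype.subsetP => _ /imsetP[theta thX ->].
rewrite !inE /= imset2_f //=; have /imsetP[[[x y] t] _ ->] := XH _ thX.
by case: (heis_mx_mulE x y t e) => _ _ ->.
Qed.

(** Sorting by the middle coordinate cuts the slice into [#|F|] fibres of [pi23]. *)
Lemma card_height_le (F : finFieldType) (E : {set 'cV[F]_3}) (k : nat) (z : F) :
  (forall yz : F * F, #|[set e in E | pi23 e == yz]| <= k)%N ->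
  (#|[set e in E | e 2%R 0%R == z]| <= #|F| * k)%N.
Proof.
move=> fib; rewrite -sum1_card.
rewrite (partition_big (fun e : 'cV[F]_3 => e 1 0) predT) //=.
rewrite -sum_nat_const; apply: leq_sum => y _.
rewrite sum1dep_card; apply: leq_trans (fib (y, z)).
apply/subset_leq_card/fintype.subsetP => e.
by rewrite !inE /pi23 xpair_eqE => /andP[/andP[-> ->] ->].
Qed.

(** Double counting of pairs [(e, f)] in [E] and [mx_image X E] at equal height, each pair weighted
    by [#|F|] to avoid dividing [#|X|] by [#|F|]. *)
Lemma card_mul_le_mx_image (F : finFieldType) (X : {set 'M[F]_3})
    (E : {set 'cV[F]_3}) (k : nat) :
  X \subset heisenberg F -> E \subset ~: horizontal_plane F ->
  (forall yz : F * F, #|[set e in E | pi23 e == yz]| <= k)%N ->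
  (#|X| * #|E| <= #|F| ^ 2 * k * #|mx_image X E|)%N.
Proof.
move=> XH /fintype.subsetP EH fib; set Y := mx_image X E.
have le1 : (#|X| * #|E| <=
    \sum_(e in E) \sum_(f in Y | f 2%R 0%R == e 2%R 0%R) #|F|)%N.
  rewrite mulnC -sum_nat_const; apply: leq_sum => e eE.
  have e2 : e 2 0 != 0 by have := EH _ eE; rewrite !inE.
  apply: leq_trans (card_le_mx_image_height XH eE e2) _.
  rewrite sum_nat_const mulnC leq_mul2r; apply/orP; right.
  by apply/subset_leq_card/fintype.subsetP => f; rewrite inE.
apply: leq_trans le1 _.
(* With [f] fixed instead, at most [#|F| * k] points [e] share its height. *)
rewrite (exchange_big_dep (mem Y)) /=; last by move=> e f _ /andP[].
rewrite [leqRHS]mulnC -sum_nat_const; apply: leq_sum => f fY.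
rewrite sum_nat_const expnS expn1 -mulnA mulnC leq_mul2l; apply/orP; right.
apply: leq_trans (card_height_le (f 2 0) fib).
apply/subset_leq_card/fintype.subsetP => e.
by rewrite !inE eq_sym -topredE /= => /andP[-> /andP[_ ->]].
Qed.

Theorem theorem1p5 (R : realType) :
  exists c : R, 0 < c /\
    forall (p : nat) (eps : R) (X : {set 'M['F_p]_3}) (E : {set 'cV['F_p]_3}),
      prime p -> odd p -> 0 <= eps ->
      X \subset heisenberg 'F_p ->
      E \subset ~: horizontal_plane 'F_p ->
      (forall yz : 'F_p * 'F_p,
         #|[set e in E | pi23 e == yz]|%:R <= p%:R `^ (1 - eps)) ->
      c * Num.min (p%:R ^+ 3)
                  (#|X|%:R * #|E|%:R / p%:R `^ (3 - eps / 2))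
        <= #|mx_image X E|%:R.
Proof.
exists 1; split=> // p eps X E p_pr _ eps0 XH EH fib.
have p0 : 0 < p%:R :> R by rewrite ltr0n prime_gt0.
have p1 : 1 <= p%:R :> R by rewrite ler1n prime_gt0.
rewrite mul1r ge_min; apply/orP; right.
rewrite ler_pdivrMr ?powR_gt0 //.
(* Fibre sizes are integers, so the real bound may be rounded down to feed the count over [nat]. *)
pose k := Num.truncn (p%:R `^ (1 - eps) : R).
have kK : k%:R <= p%:R `^ (1 - eps) :> R by rewrite truncn_le powR_ge0.
have kfib (yz : 'F_p * 'F_p) : (#|[set e in E | pi23 e == yz]| <= k)%N.
  by rewrite truncn_ge_nat ?powR_ge0.
have := card_mul_le_mx_image XH EH kfib.
rewrite card_Fp // -(ler_nat R) !natrM -expr2 => /le_trans; apply.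
rewrite mulrC ler_wpM2l //.
(* The exponents add up to [3 - eps], at most [3 - eps / 2] since [eps] is nonnegative; the base is
   at least 1. *)
apply: (@le_trans _ _ (p%:R `^ 2 * p%:R `^ (1 - eps))).
  by rewrite -powR_mulrn ?ler0n // ler_wpM2l ?powR_ge0.
rewrite -powRD; last by rewrite (gt_eqF p0) implybT.
by apply: ler_powR => //; lra.
Qed.
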